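(* The number of normal equivalence classes of (nonempty) faces of Loday's associahedron $\mathfrak a_n$ is the Catalan number $C_n=\frac1{n+1}\binom{2n}n$.
   Context: Let $n\ge1$. For nonempty $J\subseteq\{1,\dots,n\}$, $\Delta_J=\mathrm{conv}\{e_i:i\in J\}\subset\mathbb R^n$. Loday's associahedron is the Minkowski sum $\mathfrak a_n=\sum_{1\le i\le j\le n}\Delta_{\{i,i+1,\dots,j\}}\subset\mathbb R^n$. Two polytopes in $\mathbb R^n$ are normally equivalent if they have the same normal fan in $(\mathbb R^n)^*$, where the normal fan of a polytope $\mathfrak p$ consists of the cones $\{y\in(\mathbb R^n)^*:\ \mathfrak q\text{ is contained in the face of }\mathfrak p\text{ where } y\text{ is maximal}\}$ for nonempty faces $\mathfrak q$ of $\mathfrak p$. *)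

(* Defs.v *)
From HB Require Import structures.
From mathcomp Require Import all_boot all_order all_algebra.
From mathcomp Require Import boolp classical_sets functions cardinality reals convex.

Set Implicit Arguments.
Unset Strict Implicit.
Unset Printing Implicit Defensive.

Import Order.TTheory GRing.Theory Num.Theory.
Local Open Scope classical_set_scope.
Local Open Scope ring_scope.

Definition conv_hull (R : realType) (V : lmodType R) (A : set V) : set V :=
  smallest (@convex_set R V) A.

Definition minkowski_sum (R : realType) (V : lmodType R) (I : finType)
    (P : pred I) (A : I -> set V) : set V :=
  [set \sum_(i | P i) x i | x in [set x : I -> V | forall i, P i -> A i (x i)]].

(* Delta_J = conv {e_i : i in J} *)
Definition simplex (R : realType) (n : nat) (J : {set 'I_n}) : set 'rV[R]_n :=
  conv_hull [set delta_mx 0 i | i in [set` J]].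

Arguments simplex R {n} J.

(* coordinates are numbered from 0 to n - 1 *)
Definition loday (R : realType) (n : nat) : set 'rV[R]_n :=
  minkowski_sum (fun ij : 'I_n * 'I_n => (ij.1 <= ij.2)%N)
    (fun ij => simplex R [set k : 'I_n | (ij.1 <= k <= ij.2)%N]).

Arguments loday R n : clear implicits.

Section faces.
Variables (R : realType) (n : nat).
Implicit Types p q : set 'rV[R]_n.

Definition dual : Type := 'Hom('rV[R]_n, R^o).

Definition max_face p (y : dual) : set 'rV[R]_n :=
  [set x | p x /\ forall z, p z -> y z <= y x].

(* y = 0 yields p itself *)
Definition nonempty_face p q : Prop :=
  q !=set0 /\ exists y : dual, q = max_face p y.

Definition normal_cone p q : set dual := [set y | q `<=` max_face p y].

Definition normal_fan p : set (set dual) :=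
  [set normal_cone p q | q in nonempty_face p].

Definition normally_equivalent p q : Prop := normal_fan p = normal_fan q.

Definition face_classes p : set (set (set 'rV[R]_n)) :=
  [set [set q' | nonempty_face p q' /\ normally_equivalent q q']
    | q in nonempty_face p].

End faces.

Definition catalan (n : nat) : nat := ('C(2 * n, n) %/ n.+1)%N.

Lemma mul_catalan (n : nat) : (n.+1 * catalan n = 'C(2 * n, n))%N.
Proof.
rewrite /catalan mulnC divnK //.
have E : (n.+1 * 'C(2 * n, n.+1) = n * 'C(2 * n, n))%N.
  by rewrite mul_bin_left mul2n -addnn addnK.
have -> : 'C(2 * n, n) = (n.+1 * ('C(2 * n, n) - 'C(2 * n, n.+1)))%N.
  by rewrite mulnBr E mulSn addnK.
exact: dvdn_mulr.
Qed.

(* Main.v *)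
Require Import Defs.
From HB Require Import structures.
From mathcomp Require Import all_boot all_order all_algebra zify.
From mathcomp Require Import boolp classical_sets functions cardinality reals.
From mathcomp Require Import interval_inference convex.

(** The face of [a_n] on which a linear form [y] is maximal is again a
    Minkowski sum of simplices, namely the sum of the [Delta_J] where [J] runs
    over the sets [J_ij] of indices at which [y] is maximal on the interval
    [{i, ..., j}] ([face_simplex_sum]; [J_ij] is [tops y (i, j)]).  The cones
    of the normal fan of such a sum are cut out by inclusions between argmax
    sets ([normal_fan_simplex_sum]), so the fan depends only on which sets
    occur among the [J_ij], and not on how often they occur.

    Call [a] and [b] joined by [y] when [y_a = y_b] and no value of [y] between
    them is larger.  The classes of this equivalence relation are the blocks of
    a noncrossing partition of the indices, and the sets [J_ij] are exactly the
    runs of consecutive elements of a block.  Hence the noncrossing partition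
    determines the normal fan ([normal_fan_joined]).  Conversely the smallest
    cone of the fan is the space of forms that are constant on blocks, and this
    space gives the partition back ([joined_of_normal_fan]).  So the normal
    equivalence classes of faces correspond to the noncrossing partitions.

    To count them, scan the indices from left to right while keeping a stack of
    open blocks: each new index either joins a block of the stack, which closes
    the blocks above it, or opens a new block on top.  The depths of the stack
    form a sequence of positive integers, starting at 1, that never goes up by
    more than one at a time; minus the depth is a linear form that induces the
    same partition ([depths_exist]), and it is the only one of this shape
    ([depths_unique]).  These sequences satisfy the ballot recurrence, which
    leads to the Catalan number ([size_climbs_catalan]). *)

Set Implicit Arguments.
Unset Strict Implicit.
Unset Printing Implicit Defensive.

Import Order.TTheory GRing.Theory Num.Theory.
Local Open Scope ring_scope.

(** * Noncrossing partitions from real sequences *)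

Definition dominates (R : realDomainType) (f : nat -> R) (a b : nat) :=
  forall k, (a <= k <= b)%N -> f k <= f a.

(** The relation of lying in the same block of the noncrossing partition of [f].
    The symmetric form with [minn] and [maxn] makes it an equivalence. *)
Definition joined (R : realDomainType) (f : nat -> R) (a b : nat) :=
  f a = f b /\ dominates f (minn a b) (maxn a b).

Section Joined.
Variable R : realDomainType.
Implicit Types f h : nat -> R.

Lemma joinedE f a b : (a <= b)%N ->
  joined f a b <-> f a = f b /\ dominates f a b.
Proof. by move=> ab; rewrite /joined (minn_idPl ab) (maxn_idPr ab). Qed.

Lemma joined_refl f a : joined f a a.
Proof.
apply/joinedE => //; split=> // k ak; suff -> : k = a by []. lia.
Qed.

Lemma joined_sym f a b : joined f a b -> joined f b a.
Proof. by case=> fab dom; split; [rewrite fab | rewrite minnC maxnC]. Qed.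

Lemma joined_le f a b k : joined f a b ->
  (minn a b <= k <= maxn a b)%N -> f k <= f a.
Proof.
case=> fab dom /dom; rewrite /minn; case: ifP => // _; by rewrite fab.
Qed.

Lemma joined_trans f a b c : joined f a b -> joined f b c -> joined f a c.
Proof.
move=> jab jbc; have [fab _] := jab; have [fbc _] := jbc.
split=> [|k kac]; first by rewrite fab.
have -> : f (minn a c) = f a by rewrite /minn; case: ifP => // _; rewrite fab.
have [kab|kbc] : (minn a b <= k <= maxn a b \/ minn b c <= k <= maxn b c)%N.
- lia.
- exact: joined_le jab kab.
- by rewrite fab; exact: joined_le jbc kbc.
Qed.

Lemma eq_joined f h a b : (forall k, (k <= maxn a b)%N -> f k = h k) ->
  joined f a b <-> joined h a b.
Proof.
wlog suff: f h / (forall k, (k <= maxn a b)%N -> f k = h k) ->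
    joined f a b -> joined h a b.
  by move=> W E; split; apply: W => // k /E.
move=> E [fab dom]; split; first by rewrite -!E //; lia.
by move=> k kab; rewrite -!E; [exact: dom | lia | lia].
Qed.

Lemma eq_dominates f h a b : (forall k, (k <= b)%N -> f k = h k) ->
  (a <= b)%N -> dominates f a b -> dominates h a b.
Proof.
by move=> E ab dom k kab; rewrite -!E //; [exact: dom | lia].
Qed.

(** The partition does not determine domination: over the values [1, 0, 2] and
    over [-1, -2, -3] all blocks are singletons, but the first index dominates
    all of them only in the second case.  For a form [h] built from stack depths
    domination is as frequent as the partition allows, hence the one-way clause;
    the induction on [m] needs it. *)
Definition same_blocks f h m := forall a b, (a <= b < m)%N ->
  (dominates f a b -> dominates h a b) /\ (joined f a b <-> joined h a b).

Lemma dominates_pred f a b : dominates f a b.+1 -> dominates f a b.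
Proof. by move=> dom k kab; apply: dom; lia. Qed.

Lemma dominates_last f a b : f b.+1 <= f a -> dominates f a b ->
  dominates f a b.+1.
Proof.
move=> fab dom k; rewrite (leq_eqVlt k) ltnS => /andP[ak /orP[/eqP -> //|kb]].
by apply: dom; rewrite ak.
Qed.

(** The index [m] joins the block of an earlier index [c]: giving it the height
    of [c] does not change the correspondence, since every comparison of [m]
    with an earlier [a] reduces to one of [c] with [a]. *)
Lemma same_blocks_join f h m c : same_blocks f h m ->
  (c < m)%N -> joined f c m -> h m = h c -> same_blocks f h m.+1.
Proof.
move=> fh cm jcm hmc a b; rewrite ltnS (leq_eqVlt b) => /andP[ab].
case/orP=> [/eqP eb | bm]; last by apply: fh; rewrite ab.
move: ab; rewrite {}eb leq_eqVlt => /orP[/eqP -> | am].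
  split; last by split=> _; exact: joined_refl.
  by have /joinedE [] : joined h m m by exact: joined_refl.
have jcm' : joined h c m.
  have [_ dom] := (joinedE f (ltnW cm)).1 jcm.
  apply/joinedE; first exact: ltnW.
  case: m fh cm hmc {am jcm} dom => // m fh cm hmc /dominates_pred dom.
  split=> //; apply: dominates_last; first by rewrite hmc.
  by apply: (fh c m _).1 => //; lia.
have E : joined f a c <-> joined h a c.
  have [ac|ca] := leqP a c; first by apply: (fh _ _ _).2; rewrite ac.
  by split=> /joined_sym J; apply/joined_sym/(fh _ _ _).2 => //; lia.
split; last first.
  split=> J.
    by apply: joined_trans jcm'; apply/E; apply: joined_trans J (joined_sym _).
  by apply: joined_trans jcm; apply/E; apply: joined_trans J (joined_sym _).
move=> dom; have [fcm _] := jcm; have [hcm _] := jcm'.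
have hma : h m <= h a.
  have [ac|ca] := leqP a c.
    rewrite -hcm.
    by apply: (fh a c _).1 => [|k kac|]; [lia | apply: dom; lia | lia].
  have jca : joined f c a.
    apply/joinedE; first exact: ltnW.
    have [_ domc] := (joinedE f (ltnW cm)).1 jcm.
    have fac : f c = f a.
      apply/le_anti/andP; split; first by rewrite fcm; apply: dom; lia.
      by apply: domc; lia.
    by split=> // k kca; apply: domc; lia.
  have ca_m : (c <= a < m)%N by rewrite ltnW.
  by have [<- _] := (fh _ _ ca_m).2.1 jca; rewrite hcm.
case: m fh am dom hma {cm jcm hmc jcm' fcm hcm} => // m fh am dom hma.
apply: dominates_last => //; apply: (fh a m _).1; first lia.
exact: dominates_pred.
Qed.

(** The index [m] opens a new block: a height below that of its predecessor
    keeps it apart from every earlier index, because an index that dominates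
    [m - 1] is at least as high as [m - 1]. *)
Lemma same_blocks_open f h m : same_blocks f h m ->
  (forall c, (c < m)%N -> ~ joined f c m) ->
  (forall k, k.+1 = m -> h m < h k) -> same_blocks f h m.+1.
Proof.
move=> fh new hm a b; rewrite ltnS (leq_eqVlt b) => /andP[ab].
case/orP=> [/eqP eb | bm]; last by apply: fh; rewrite ab.
move: ab; rewrite {}eb leq_eqVlt => /orP[/eqP -> | am].
  split; last by split=> _; exact: joined_refl.
  by have /joinedE [] : joined h m m by exact: joined_refl.
case: m fh new hm am => // m fh new hm am.
have dom_lt : dominates h a m -> h m.+1 < h a.
  move=> dom; apply: (lt_le_trans (hm _ erefl)); apply: dom; lia.
split=> [dom|].
  have dom' : dominates h a m.
    by apply: (fh a m _).1; [lia | exact: dominates_pred].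
  by apply: dominates_last => //; exact/ltW/dom_lt.
split=> [/(new _ am) //|/joinedE [|ham /dominates_pred /dom_lt]]; first lia.
by rewrite ham ltxx.
Qed.

End Joined.

(** * Depth sequences *)

(** Depth sequences are the paths for this relation that start from 0, which
    forces the first depth to be 1; the initial 0 is not part of them. *)
Definition climb (i j : nat) := (0 < j <= i.+1)%N.

(** The sign turns the deepest blocks of the stack into the lowest ones, so that
    an outer block dominates the blocks nested in it. *)
Definition height (R : realDomainType) (s : seq nat) (k : nat) : R :=
  - (nth 0%N s k)%:R.

Section Depths.
Variable R : realDomainType.
Implicit Types f : nat -> R.
Implicit Types s : seq nat.

Lemma height_le s a b : (height R s a <= height R s b) =
  (nth 0 s b <= nth 0 s a)%N.
Proof. by rewrite lerN2 ler_nat. Qed.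

Lemma height_inj s a b : height R s a = height R s b ->
  nth 0%N s a = nth 0%N s b.
Proof. by move/oppr_inj/eqP; rewrite eqr_nat => /eqP. Qed.

Lemma same_blocks_rcons f s x : same_blocks f (height R s) (size s) ->
  same_blocks f (height R (rcons s x)) (size s).
Proof.
move=> fs a b /[dup] abs /fs[D J].
have E k : (k <= b)%N -> height R s k = height R (rcons s x) k.
  by move=> kb; rewrite /height nth_rcons; case: ltnP => //; lia.
split=> [/D|]; first by apply: eq_dominates => //; lia.
by rewrite J; apply: eq_joined => k kab; apply: E; lia.
Qed.

(** The depth of a new index is that of the block it joins, or one more than the
    previous depth if it joins none. *)
Lemma depths_exist f m : exists s,
  [/\ size s = m, path climb 0%N s & same_blocks f (height R s) m].
Proof.
elim: m => [|m [s [sz cl fs]]]; first by exists [::]; split=> // a b; lia.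
have fs' x : same_blocks f (height R (rcons s x)) m.
  by rewrite -sz; apply: same_blocks_rcons; rewrite sz.
have step x : climb (last 0%N s) x ->
    same_blocks f (height R (rcons s x)) m.+1 ->
    exists s, [/\ size s = m.+1, path climb 0%N s &
                  same_blocks f (height R s) m.+1].
  by exists (rcons s x); rewrite size_rcons sz rcons_path cl.
have pos a : (a < m)%N -> (0 < nth 0 s a)%N.
  by rewrite -sz => /((pathP 0%N cl)) /andP[].
have [[c [cm jcm]]|new] := pselect (exists c, (c < m)%N /\ joined f c m).
  have [_ dom] := (joinedE f (ltnW cm)).1 jcm.
  apply: (step (nth 0%N s c)).
    rewrite /climb pos //= -nth_last.
    apply: leqW; rewrite -height_le.
    apply: (fs c (size s).-1 _).1 => [|k kc|]; rewrite -?sz in cm *; first lia.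
      by apply: dom; lia.
    lia.
  apply: (same_blocks_join (fs' _) cm jcm).
  by rewrite /height !nth_rcons sz ltnn eqxx cm.
apply: (step (last 0%N s).+1); first by rewrite /climb leqnn.
apply: same_blocks_open => // [c cm jcm|k km]; first by apply: new; exists c.
rewrite /height !nth_rcons sz ltnn eqxx -km ltnSn ltrN2 ltr_nat -nth_last sz.
rewrite -km.
exact: ltnSn.
Qed.

(** Depths increase by at most one at a time, so a sequence that has come down
    to a given depth took that value before: the last earlier index at which the
    depth is at most [s_(m+1)] is joined with [m + 1]. *)
Lemma climb_joined s m : path climb 0%N s -> (m.+1 < size s)%N ->
  (nth 0 s m.+1 <= nth 0 s m)%N ->
  exists2 a : nat, (a <= m)%N & joined (height R s) a m.+1.
Proof.
move=> /(pathP 0%N) cl ms sm.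
have s0 : (0 <= m)%N && (nth 0 s 0 <= nth 0 s m.+1)%N.
  have /andP[_ le1] := cl 0%N (leq_trans (ltn0Sn _) ms).
  have /andP[gt0 _] := cl _ ms.
  exact: leq_trans le1 gt0.
pose low a := (a <= m)%N && (nth 0 s a <= nth 0 s m.+1)%N.
have ub a : low a -> (a <= m)%N by case/andP.
case: (ex_maxnP (ex_intro low 0%N s0) ub) => a /andP[am sa] amax.
exists a => //; have sE : nth 0%N s a = nth 0%N s m.+1.
  apply/eqP; rewrite eqn_leq sa /=; move: am; rewrite leq_eqVlt.
  case/orP=> [/eqP -> // | am].
  have /andP[_ /= up] := cl a.+1 (leq_ltn_trans am (ltnW ms)).
  rewrite -ltnS; apply: leq_trans up; rewrite ltnNge; apply/negP => le.
  by have := amax a.+1; rewrite /low am le ltnn => /(_ isT).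
apply/joinedE; first exact: leqW.
split=> [|k /andP[ak kb]]; first by rewrite /height sE.
rewrite height_le sE.
have [//|lt] := leqP (nth 0%N s m.+1) (nth 0%N s k).
have km : (k <= m)%N.
  by rewrite -ltnS ltn_neqAle kb andbT; apply/eqP => km; rewrite km ltnn in lt.
have /amax ka : low k by rewrite /low km ltnW.
have /eqP ek : k == a by rewrite eqn_leq ak ka.
by rewrite ek sE ltnn in lt.
Qed.

(** Whether the depth goes up at [m], and otherwise which earlier value it
    takes, can be read from the indices joined with [m]. *)
Lemma depths_unique n s t : size s = n -> size t = n ->
  path climb 0%N s -> path climb 0%N t ->
  (forall a b, (a <= b < n)%N ->
     joined (height R s) a b <-> joined (height R t) a b) ->
  s = t.
Proof.
move=> ss st cs ct J.
apply: (@eq_from_nth _ 0%N); rewrite ss // => m.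
elim/ltn_ind: m => m IH mn.
have step u v : size u = n -> path climb 0%N u ->
    (forall a b, (a <= b < n)%N ->
       joined (height R u) a b -> joined (height R v) a b) ->
    (forall a, (a < m)%N -> nth 0%N u a = nth 0%N v a) ->
    forall k, k.+1 = m -> (nth 0 u m <= nth 0 u k)%N ->
    nth 0%N u m = nth 0%N v m.
  move=> su cu uv IHu k km; rewrite -km => le.
  have [|a ak ja] := climb_joined cu _ le; first by rewrite su km.
  rewrite -(height_inj ja.1) IHu ?km -?km //.
  by apply/height_inj/(uv _ _ _ ja).1; lia.
case: m mn IH step => [|k] kn IH step.
  have := pathP 0%N cs 0%N; have := pathP 0%N ct 0%N; rewrite ss st kn.
  by move=> /(_ isT) + /(_ isT); rewrite /climb /=; lia.
have [le|lts] := leqP (nth 0%N s k.+1) (nth 0%N s k).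
  apply: (step s t ss cs _ _ k) => // [a b ab|a ak]; first by apply J.
  by apply: IH => //; lia.
have [le|ltt] := leqP (nth 0%N t k.+1) (nth 0%N t k).
  symmetry; apply: (step t s st ct _ _ k) => // [a b ab|a ak]; first by apply J.
  by symmetry; apply: IH => //; lia.
have := pathP 0%N cs k.+1; have := pathP 0%N ct k.+1; rewrite ss st kn.
move=> /(_ isT) /andP[_ /= t1] /(_ isT) /andP[_ /= s1].
have := IH k (ltnSn _) (ltnW kn). lia.
Qed.

End Depths.

(** * Counting depth sequences *)

Fixpoint climbs (m k : nat) : seq (seq nat) :=
  if m is m'.+1 then [seq j :: t | j <- iota 1 k.+1, t <- climbs m' j]
  else [:: [::]].

Lemma climbsS m k :
  climbs m.+1 k = [seq j :: t | j <- iota 1 k.+1, t <- climbs m j].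
Proof. by []. Qed.

Lemma mem_climbs m k t : (t \in climbs m k) = (size t == m) && path climb k t.
Proof.
elim: m k t => [|m IH] k [|j t] //; rewrite climbsS.
  by apply/negbTE/negP => /allpairsPdep [? [? []]].
apply/allpairsPdep/idP => [[j' [t' [jk + [-> ->]]]]|].
  have jk' : (0 < j' <= k.+1)%N.
    by have := jk; rewrite (mem_iota 1 k.+1) add1n ltnS.
  by rewrite IH /= eqSS /climb jk'.
rewrite /= eqSS => /and3P[sz jk tp].
by exists j, t; rewrite IH sz tp (mem_iota 1 k.+1) add1n.
Qed.

Lemma climbs_uniq m k : uniq (climbs m k).
Proof.
elim: m k => // m IH k; rewrite climbsS.
apply: allpairs_uniq_dep => // [|[a b] [c d] _ _ /= [-> ->]] //.
exact: iota_uniq.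
Qed.

Lemma size_climbsS m k :
  size (climbs m.+1 k) = sumn [seq size (climbs m j) | j <- iota 1 k.+1].
Proof. by rewrite climbsS size_allpairs_dep. Qed.

Lemma size_climbsS0 m : size (climbs m.+1 0) = size (climbs m 1).
Proof. by rewrite size_climbsS; exact: addn0. Qed.

Lemma size_climbsSS m k :
  size (climbs m.+1 k.+1) = (size (climbs m.+1 k) + size (climbs m k.+2))%N.
Proof.
rewrite !size_climbsS -[k.+2 in LHS]addn1 iotaD map_cat sumn_cat /=.
by rewrite addn0 add1n.
Qed.

(** The ballot number [C(2m + k, m) - C(2m + k, m - 1)]; the index is shifted to
    [m.+1] and the negative term moved to the left. *)
Lemma size_climbs m k :
  (size (climbs m.+1 k) + 'C((2 * m.+1 + k), m) = 'C(2 * m.+1 + k, m.+1))%N.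
Proof.
elim: m k => [k|m IH].
  have sumn1 i l : sumn [seq size (climbs 0 j) | j <- iota i l] = l.
    by elim: l i => //= l IHl i; rewrite IHl add1n.
  by rewrite size_climbsS sumn1 bin0 bin1; lia.
elim=> [|k IHk].
  rewrite size_climbsS0 addn0.
  have := IH 1%N; set N := (2 * m.+1 + 1)%N => E.
  have -> : (2 * m.+2 = N.+1)%N by lia.
  (* [m + 1] and [m + 2] add up to [N], the row of the binomials. *)
  have sym : 'C(N, m.+2) = 'C(N, m.+1).
    by rewrite -bin_sub; [congr 'C(_, _) | ]; lia.
  by rewrite (binS N m.+1) (binS N m) sym; lia.
have := IH k.+2; have -> : (2 * m.+1 + k.+2 = 2 * m.+2 + k)%N by lia.
by rewrite (size_climbsSS m.+1 k) addnS !(binS (_ + _)); lia.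
Qed.

Lemma size_climbs_catalan n : (0 < n)%N -> size (climbs n 0) = catalan n.
Proof.
case: n => // n _; apply/eqP.
rewrite -(eqn_pmul2l (ltn0Sn n.+1)) mul_catalan; apply/eqP.
have := size_climbs n 0; rewrite addn0.
have := mul_bin_left (2 * n.+1) n.
have -> : (2 * n.+1 - n = n.+2)%N by lia.
move: 'C(_, _) => A; move: 'C(_, _) => B; nia.
Qed.

Local Open Scope classical_set_scope.

(** * Faces of simplices *)

Section LinearForms.
Variables (R : realType) (n : nat).
Implicit Types (y z w : dual R n) (J K : {set 'I_n}) (c : 'I_n -> R).

Definition vweight z (k : 'I_n) : R := z (delta_mx 0 k).

Definition linform_fun c (x : 'rV[R]_n) : R^o := \sum_k x 0 k * c k.

Fact linform_fun_linear c : linear (linform_fun c).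
Proof.
move=> a x x'; rewrite /linform_fun scaler_sumr -big_split /=.
by apply: eq_bigr => k _; rewrite !mxE mulrDl -mulrA.
Qed.

HB.instance Definition _ c :=
  GRing.isLinear.Build R 'rV[R]_n R^o *:%R (linform_fun c)
    (linform_fun_linear c).

Definition linform c : dual R n := linfun (linform_fun c).

Lemma vweight_linform c k : vweight (linform c) k = c k.
Proof.
rewrite /vweight lfunE /= /linform_fun (bigD1 k) //= mxE !eqxx mul1r.
rewrite big1 ?addr0 // => l lk; rewrite mxE eqxx /=.
by rewrite (negbTE lk) mul0r.
Qed.

Definition top z J : {set 'I_n} :=
  [set k in J | [forall l in J, vweight z l <= vweight z k]].

Lemma topP z J k : reflect
  (k \in J /\ forall l, l \in J -> vweight z l <= vweight z k) (k \in top z J).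
Proof.
rewrite inE; apply: (iffP andP) => -[kJ].
  by move=> /forall_inP.
by move=> H; split=> //; apply/forall_inP.
Qed.

Lemma top_sub z J : top z J \subset J.
Proof. by apply/fintype.subsetP => k /topP[]. Qed.

Lemma top_nonempty z J : (exists k, k \in J) -> exists k, k \in top z J.
Proof.
move=> [k0 k0J]; have [k kJ kmax] := arg_maxP (vweight z) k0J.
by exists k; apply/topP.
Qed.

Lemma vweight_top z J k l : k \in top z J -> l \in top z J ->
  vweight z k = vweight z l.
Proof.
move=> /topP[kJ kmax] /topP[lJ lmax].
by apply/le_anti; rewrite kmax // lmax.
Qed.

Lemma simplex_convex J : convex_set (simplex R J).
Proof.
move=> x x' t; rewrite !inE => Jx Jx' A [cA sA].
apply: set_mem; apply: (cA); apply: mem_set.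
  exact: (Jx A (conj cA sA)).
exact: (Jx' A (conj cA sA)).
Qed.

Lemma simplex_vertex J k : k \in J -> simplex R J (delta_mx 0 k).
Proof. by move=> kJ A [_ sA]; apply: sA; exists k. Qed.

Lemma simplex_mono J K : J \subset K -> simplex R J `<=` simplex R K.
Proof.
move=> /fintype.subsetP JK; apply: smallest_sub; first exact: simplex_convex.
by move=> _ [k /JK kK <-]; apply: simplex_vertex.
Qed.

(** The points [x] that satisfy the conclusion form a convex set: if a proper
    convex combination reaches the bound [m], then so do both of its ends.  The
    set contains the vertices of the simplex, hence the simplex. *)
Lemma simplex_le z J m x : (forall k, k \in J -> vweight z k <= m) ->
  simplex R J x -> z x <= m /\ (z x = m -> simplex R (top z J) x).
Proof.
move=> Jm; apply: (@smallest_sub _ _ _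
  [set x | z x <= m /\ (z x = m -> simplex R (top z J) x)]); last first.
  move=> _ [k kJ <-]; split; first exact: Jm.
  by move=> km; apply: simplex_vertex; apply/topP; split=> // l /Jm;
    rewrite -km.
apply/convex_setW => a b; rewrite !inE /= => -[am aJ] [bm bJ] t t0 t1.
set u := t%:num in t0 t1 *.
have -> : conv t a b = u *: (a : 'rV[R]_n) + (1 - u) *: (b : 'rV[R]_n) by [].
rewrite inE /= linearD !linearZ /=.
have u0 : 0 < u by []. have v0 : 0 < 1 - u by rewrite subr_gt0.
have mE : m = u * m + (1 - u) * m by rewrite -mulrDl subrKC mul1r.
have uam : u * z a <= u * m by rewrite ler_pM2l.
have vbm : (1 - u) * z b <= (1 - u) * m by rewrite ler_pM2l.
split=> [|zm]; first by rewrite [X in _ <= X]mE; exact: lerD.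
have za : z a = m.
  apply/le_anti; rewrite am -(ler_pM2l u0) -(lerD2r ((1 - u) * m)) -mE.
  rewrite -[X in X <= _]zm.
  by rewrite lerD2l.
have zb : z b = m.
  apply/le_anti; rewrite bm -(ler_pM2l v0) -(lerD2l (u * m)) -mE.
  rewrite -[X in X <= _]zm.
  by rewrite lerD2r.
by apply: set_mem; apply: simplex_convex; apply: mem_set;
  [exact: aJ | exact: bJ].
Qed.

Lemma simplex_top z J k x : k \in top z J -> simplex R (top z J) x ->
  z x = vweight z k.
Proof.
move=> kJ; apply: (@smallest_sub _ _ _ [set x | z x = vweight z k]).
  move=> a b t; rewrite !inE /= => az bz.
  have -> : conv t a b =
    t%:num *: (a : 'rV[R]_n) + (1 - t%:num) *: (b : 'rV[R]_n) by [].
  by rewrite linearD !linearZ /= az bz -scalerDl subrKC scale1r.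
by move=> _ [l lJ <-]; exact: vweight_top lJ kJ.
Qed.

End LinearForms.

(** * Minkowski sums of simplices *)

Lemma eq_of_sum_le (R : realDomainType) (I : finType) (P : pred I)
    (a b : I -> R) : (forall i, P i -> a i <= b i) ->
  \sum_(i | P i) b i <= \sum_(i | P i) a i -> forall i, P i -> a i = b i.
Proof.
move=> ab sba i Pi.
have [_] := leif_sum (fun i Pi => leif_eq (ab i Pi)).
by rewrite eq_le sba ler_sum // => /esym/forall_inP/(_ i Pi)/eqP.
Qed.

Section SimplexSums.
Variables (R : realType) (n : nat) (I : finType) (P : pred I).
Implicit Types (y z w : dual R n) (K L : I -> {set 'I_n}).

Definition simplex_sum K : set 'rV[R]_n :=
  minkowski_sum P (fun i => simplex R (K i)).

Definition nonempty_on K := forall i, P i -> exists k, k \in K i.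

Lemma vertices_exist K : nonempty_on K -> exists v : I -> 'rV[R]_n,
  forall i, P i -> exists2 k, k \in K i & v i = delta_mx 0 k.
Proof.
move=> K0; suff /choice[v vP] : forall i, exists v : 'rV[R]_n,
    P i -> exists2 k, k \in K i & v = delta_mx 0 k by exists v.
move=> i; have [Pi|] := boolP (P i); last by exists 0.
by have [k kK] := K0 i Pi; exists (delta_mx 0 k) => _; exists k.
Qed.

Lemma top_nonempty_on z K : nonempty_on K -> nonempty_on (fun i => top z (K i)).
Proof. by move=> K0 i /K0/top_nonempty. Qed.

Lemma dual_sum z (u : I -> 'rV[R]_n) :
  z (\sum_(i | P i) u i) = \sum_(i | P i) (z (u i) : R).
Proof. exact: linear_sum. Qed.

(** The maximum of [z] on the sum is the sum of the maxima on the summands, so a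
    point is maximal exactly when each of its components is. *)
Lemma max_face_simplex_sum z K : nonempty_on K ->
  max_face (simplex_sum K) z = simplex_sum (fun i => top z (K i)).
Proof.
move=> K0; have [v vtop] := vertices_exist (top_nonempty_on z K0).
have ub i u : P i -> simplex R (K i) u ->
    z u <= z (v i) /\ (z u = z (v i) -> simplex R (top z (K i)) u).
  by move=> /vtop[k /topP[_ kmax] ->]; exact: simplex_le.
apply/seteqP; split=> [_ [[u /= uK <-] umax]|_ [u /= utop <-]].
  exists u => //= i Pi; apply: (ub i _ Pi (uK i Pi)).2; move: i Pi.
  apply: eq_of_sum_le => [i Pi|]; first exact: (ub i _ Pi (uK i Pi)).1.
  rewrite -!dual_sum; apply: umax; exists v => //= i /vtop[k ktop ->].
  by apply: simplex_vertex; exact: fintype.subsetP (top_sub z _) _ ktop.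
split=> [|_ [t /= tK <-]].
  by exists u => //= i Pi; apply: (simplex_mono (top_sub z (K i))); exact: utop.
rewrite !dual_sum; apply: ler_sum => i Pi.
have [k ktop vk] := vtop i Pi.
rewrite (simplex_top ktop (utop i Pi)) /vweight -vk.
exact: (ub i _ Pi (tK i Pi)).1.
Qed.

Lemma max_face_nonempty z K : nonempty_on K ->
  max_face (simplex_sum K) z !=set0.
Proof.
move=> K0; rewrite max_face_simplex_sum //.
have [v vtop] := vertices_exist (top_nonempty_on z K0).
exists (\sum_(i | P i) v i), v => //= i /vtop[k ktop ->].
exact: simplex_vertex.
Qed.

(** To see that a vertex [k0] of one summand is maximal for [w], complete it by
    arbitrary vertices of the other summands: a maximal sum has maximal
    terms. *)
Lemma sub_max_face w K L : nonempty_on L ->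
  (forall i, P i -> L i \subset K i) ->
  simplex_sum L `<=` max_face (simplex_sum K) w <->
  forall i, P i -> L i \subset top w (K i).
Proof.
move=> L0 LK.
have K0 : nonempty_on K.
  by move=> i Pi; have [k /(fintype.subsetP (LK i Pi)) kK] := L0 i Pi; exists k.
split=> [sub i0 Pi0|sub]; last first.
  rewrite max_face_simplex_sum // => _ [u /= uL <-]; exists u => //= i Pi.
  by apply: (simplex_mono (sub i Pi)); exact: uL.
apply/fintype.subsetP => k0 k0L.
have [v vL] := vertices_exist L0.
have [t ttop] := vertices_exist (top_nonempty_on w K0).
pose u i := if i == i0 then delta_mx 0 k0 else v i.
have uL i : P i -> exists2 k, k \in L i & u i = delta_mx 0 k.
  rewrite /u; case: eqP => [-> _|_]; [by exists k0 | exact: vL].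
have [_ umax] : max_face (simplex_sum K) w (\sum_(i | P i) u i).
  by apply: sub; exists u => //= i /uL[k kL ->]; apply: simplex_vertex.
have ut : forall i, P i -> w (u i) = w (t i).
  apply: eq_of_sum_le => [i Pi|].
    have [k kL ->] := uL i Pi; have [l /topP[_ lmax] ->] := ttop i Pi.
    by apply: lmax; exact: fintype.subsetP (LK i Pi) _ kL.
  rewrite -!dual_sum; apply: umax; exists t => //= i /ttop[k ktop ->].
  by apply: simplex_vertex; exact: fintype.subsetP (top_sub w _) _ ktop.
have := ut i0 Pi0; rewrite /u eqxx => wk0.
have [l /topP[lK lmax] tl] := ttop i0 Pi0.
apply/topP; split=> [|k kK]; first exact: fintype.subsetP (LK i0 Pi0) _ k0L.
by rewrite /vweight wk0 tl; exact: lmax.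
Qed.

Definition fan_cone K z : set (dual R n) :=
  [set w | forall i, P i -> top z (K i) \subset top w (K i)].

Lemma normal_fan_simplex_sum K : nonempty_on K ->
  normal_fan (simplex_sum K) = range (fan_cone K).
Proof.
move=> K0.
have coneE z :
    normal_cone (simplex_sum K) (max_face (simplex_sum K) z) = fan_cone K z.
  apply/seteqP; rewrite max_face_simplex_sum //.
  have sub i : P i -> top z (K i) \subset K i by rewrite top_sub.
  by split=> w /(sub_max_face w (top_nonempty_on z K0) sub).
apply/seteqP; split=> [_ [q [_ [z ->]] <-]|_ [z _ <-]]; first by exists z.
exists (max_face (simplex_sum K) z) => //.
by split; [exact: max_face_nonempty | exists z].
Qed.

End SimplexSums.

(** * Faces of the associahedron and their normal fans *)

Section LodayFaces.
Variables (R : realType) (n : nat).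
Implicit Types (y z w : dual R n) (i j a b k : 'I_n) (ij : 'I_n * 'I_n).

Definition ordered : pred ('I_n * 'I_n) := fun ij => (ij.1 <= ij.2)%N.

Definition interval ij : {set 'I_n} := [set k : 'I_n | (ij.1 <= k <= ij.2)%N].

Lemma interval_nonempty : nonempty_on ordered interval.
Proof. by move=> [i j] ij; exists i; rewrite inE leqnn. Qed.

Definition tops y ij := top y (interval ij).

Lemma tops_nonempty y : nonempty_on ordered (tops y).
Proof. exact: top_nonempty_on interval_nonempty. Qed.

Definition face y : set 'rV[R]_n := max_face (loday R n) y.

Lemma face_simplex_sum y : face y = simplex_sum ordered (tops y).
Proof. exact/max_face_simplex_sum/interval_nonempty. Qed.

Lemma face_nonempty_face y : nonempty_face (loday R n) (face y).
Proof.
by split; [exact: max_face_nonempty interval_nonempty | exists y].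
Qed.

Lemma normal_fan_face y :
  normal_fan (face y) = range (fan_cone ordered (tops y)).
Proof.
by rewrite face_simplex_sum normal_fan_simplex_sum //; exact: tops_nonempty.
Qed.

(** The values of [y] at the vertices of the simplex, as a sequence indexed by
    all natural numbers; only the first [n] terms matter. *)
Definition profile y (k : nat) : R := oapp (vweight y) 0 (insub k).

Lemma profileE y k : profile y k = vweight y k.
Proof. by rewrite /profile valK. Qed.

Lemma tops_joined y a b k : (a <= b)%N -> joined (profile y) a b ->
  k \in tops y (a, b) <-> (a <= k <= b)%N /\ joined (profile y) a k.
Proof.
move=> ab /(joinedE _ ab)[yab dom]; split=> [/topP[]|[kab jak]].
  rewrite inE /= => kab kmax; split=> //; apply/joinedE; first lia.
  split=> [|l lk]; last by apply: dom; lia.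
  apply/le_anti; rewrite [X in _ && X]dom // andbT !profileE kmax //.
  by rewrite inE /= leqnn.
apply/topP; rewrite inE; split=> // l; rewrite inE /= => lab.
by rewrite -!profileE -jak.1; exact: dom.
Qed.

(** The first and the last element of [J_ij] are joined, and shrinking the
    interval to them does not change the set of maximal indices.  With
    [tops_joined] this exhibits [J_ij] as a run of consecutive elements of one
    block. *)
Lemma tops_endpoints y i j : (i <= j)%N -> exists a b,
  [/\ (a <= b)%N, joined (profile y) a b & tops y (i, j) = tops y (a, b)].
Proof.
move=> ij; have [k0 k0top] := tops_nonempty y (i := (i, j)) ij.
case: (arg_minnP (fun k => val k) k0top) => a atop amin.
case: (arg_maxnP (fun k => val k) k0top) => b btop bmax.
have [+ aub] := topP _ _ _ atop; rewrite inE /= => /andP[ia aj].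
have [+ bub] := topP _ _ _ btop; rewrite inE /= => /andP[ib bj].
have ab : (a <= b)%N by exact: amin.
exists a, b; split=> //.
  apply/joinedE => //; split=> [|k kab].
    by rewrite !profileE; exact: vweight_top atop btop.
  have kn : (k < n)%N by have := ltn_ord b; lia.
  rewrite -[k]/(val (Ordinal kn)) !profileE; apply: aub; rewrite inE /=; lia.
apply/setP => k; apply/idP/idP => [ktop|/topP[]].
  have [+ kub] := topP _ _ _ ktop; rewrite inE /= => kij.
  apply/topP; rewrite inE /= (amin k ktop); split; first exact: bmax.
  by move=> l; rewrite inE /= => lab; apply: kub; rewrite inE /=; lia.
rewrite inE /= => kab kub; apply/topP; rewrite inE /=; split; first lia.
move=> l /aub /le_trans; apply; apply: kub; rewrite inE /=; lia.
Qed.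

Lemma tops_eq y y' i j :
  (forall a b, joined (profile y) a b <-> joined (profile y') a b) ->
  (i <= j)%N -> exists2 ij', ordered ij' & tops y (i, j) = tops y' ij'.
Proof.
move=> J ij; have [a [b [ab jab ->]]] := tops_endpoints y ij.
exists (a, b) => //; apply/setP => k; apply/idP/idP.
  move=> /(tops_joined _ ab jab)[kab /J jak].
  by apply/tops_joined => //; exact/J.
move=> /(tops_joined _ ab ((J _ _).1 jab))[kab /J jak].
by apply/tops_joined.
Qed.

(** A cone is an intersection of conditions indexed by the sets [J_ij], whatever
    their labels [ij]. *)
Lemma fan_cone_sub y y' z :
  (forall a b, joined (profile y) a b <-> joined (profile y') a b) ->
  fan_cone ordered (tops y') z `<=` fan_cone ordered (tops y) z.
Proof.
move=> J w wz [i j] /= ij; have [ij' oij' ->] := tops_eq J ij.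
exact: wz.
Qed.

Lemma normal_fan_joined y y' :
  (forall a b, joined (profile y) a b <-> joined (profile y') a b) ->
  normal_fan (face y) = normal_fan (face y').
Proof.
move=> J; rewrite !normal_fan_face; suff -> :
    fan_cone (R := R) ordered (tops y) = fan_cone ordered (tops y') by [].
apply/funext => z; apply/seteqP; split; apply: fan_cone_sub => // a b.
by split=> /J.
Qed.

Definition zero_dual : dual R n := (0 : 'Hom('rV[R]_n, R^o)).

(** The cone of the zero form is the lineality space of the fan, the forms that
    are constant on each [J_ij]. *)
Lemma lineality_sub y z :
  fan_cone ordered (tops y) zero_dual `<=` fan_cone ordered (tops y) z.
Proof.
move=> w w0 ij oij; apply/fintype.subsetP => k /topP[kK _].
apply: (fintype.subsetP (w0 ij oij)); apply/topP; split=> // l _.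
by rewrite /vweight !lfunE.
Qed.

(** Equal fans have equal smallest cones.  The indicator of the block of [a] in
    the partition of [y'] lies in the smallest cone for [y'], so it is constant
    on the blocks of [y]. *)
Lemma joined_of_normal_fan y y' a b :
  normal_fan (face y) = normal_fan (face y') ->
  joined (profile y) a b -> joined (profile y') a b.
Proof.
wlog ab : a b / (a <= b)%N => [W|] E.
  have [ab|/ltnW ba] := leqP a b; first exact: W.
  by move=> /joined_sym /(W _ _ ba E)/joined_sym.
move=> jab.
pose c k : R := (`[< joined (profile y') a k >])%:R.
have c0 : fan_cone ordered (tops y') zero_dual (linform c).
  move=> [i j] ij; apply/fintype.subsetP => k /topP[ktop _].
  apply/topP; split=> // l ltop.
  rewrite !vweight_linform /c.
  suff -> : `[< joined (profile y') a k >] =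
    `[< joined (profile y') a l >] by [].
  apply/asbool_equiv_eq.
  have [a' [b' [ab' jab' E']]] := tops_endpoints y' ij.
  rewrite E' in ktop ltop.
  have [_ jk] := (tops_joined _ ab' jab').1 ktop.
  have [_ jl] := (tops_joined _ ab' jab').1 ltop.
  have jkl : joined (profile y') k l.
    by apply: joined_trans jl; exact: joined_sym.
  by split=> ja; apply: (joined_trans ja) => //; exact: joined_sym.
have : normal_fan (face y') (fan_cone ordered (tops y) zero_dual).
  by rewrite -E normal_fan_face; exists zero_dual.
rewrite normal_fan_face => -[z _ Ez].
have := lineality_sub z c0; rewrite Ez => /(_ (a, b) ab) /fintype.subsetP sub.
have mem k : k \in tops y (a, b) -> k \in top (linform c) (tops y (a, b)).
  move=> kK; apply: sub; apply/topP; split=> // l _.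
  by rewrite /vweight !lfunE.
have atop : a \in tops y (a, b).
  by apply/tops_joined => //; split; [rewrite leqnn | exact: joined_refl].
have btop : b \in tops y (a, b).
  by apply/tops_joined => //; split; [rewrite leqnn andbT | ].
have := vweight_top (mem _ atop) (mem _ btop).
rewrite !vweight_linform /c asboolT; last exact: joined_refl.
by case: asboolP => // _ /eqP; rewrite oner_eq0.
Qed.

End LodayFaces.

(** * The number of classes *)

Definition depth_dual (R : realType) (n : nat) (s : seq nat) : dual R n :=
  linform (fun k : 'I_n => height R s k).

Lemma profile_depth_dual (R : realType) (n : nat) (s : seq nat) (a b : 'I_n) :
  joined (profile (depth_dual R n s)) a b <-> joined (height R s) a b.
Proof.
apply: eq_joined => k kab.
have kn : (k < n)%N by have := ltn_ord a; have := ltn_ord b; lia.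
by rewrite -[k]/(val (Ordinal kn)) profileE vweight_linform.
Qed.

Lemma normal_fan_depth (R : realType) (n : nat) (y : dual R n) :
  exists2 s, s \in climbs n 0 &
    normal_fan (face y) = normal_fan (face (depth_dual R n s)).
Proof.
have [s [sz cl same]] := depths_exist (profile y) n.
exists s; first by rewrite mem_climbs sz eqxx.
apply: normal_fan_joined => a b; rewrite profile_depth_dual.
have [ab|/ltnW ba] := leqP a b; first by apply: (same a b _).2; rewrite ab /=.
by split=> /joined_sym J; apply/joined_sym/(same b a _).2; rewrite ?ba /=.
Qed.

Lemma normal_fan_depth_inj (R : realType) (n : nat) (s t : seq nat) :
  s \in climbs n 0 -> t \in climbs n 0 ->
  normal_fan (face (depth_dual R n s)) = normal_fan (face (depth_dual R n t)) ->
  s = t.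
Proof.
rewrite !mem_climbs => /andP[/eqP sz cs] /andP[/eqP tz ct] E.
apply: (depths_unique (R := R) sz tz cs ct) => a b /andP[ab bn].
have an := leq_ltn_trans ab bn.
have := joined_of_normal_fan (a := Ordinal an) (b := Ordinal bn) E.
have := joined_of_normal_fan (a := Ordinal an) (b := Ordinal bn) (esym E).
rewrite !profile_depth_dual /=; by [].
Qed.

Local Open Scope card_scope.

Theorem corollary25p10 (R : realType) (n : nat) (hn : (1 <= n)%N) :
  face_classes (loday R n) #= `I_(catalan n).
Proof.
pose cls (q : set 'rV[R]_n) :=
  [set q' | nonempty_face (loday R n) q' /\ normally_equivalent q q'].
pose f (i : nat) := face (depth_dual R n (nth [::] (climbs n 0) i)).
have -> : face_classes (loday R n) = [set cls (f i) | i in `I_(catalan n)].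
  apply/seteqP; split=> [_ [_ [_ [y ->]] <-]|_ [i _ <-]].
    have [s sin E] := normal_fan_depth y.
    exists (index s (climbs n 0)) => /=.
      by rewrite -size_climbs_catalan // index_mem.
    by rewrite /cls /normally_equivalent /f nth_index // -E.
  by exists (f i) => //; exact: face_nonempty_face.
apply: inj_card_eq => i j; rewrite !inE /= -size_climbs_catalan // => ilt jlt E.
have : cls (f j) (f j) by split=> //; exact: face_nonempty_face.
rewrite -E => -[_ /normal_fan_depth_inj fE].
by apply/eqP; rewrite -(nth_uniq [::] ilt jlt (climbs_uniq n 0)) fE ?mem_nth.
Qed.
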